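(* Let $m$ and $e$ be integers such that $2\leq e\leq m$, and let $A$ be a subset of $\{1,\ldots,m-1\}$ with cardinality $e-1$ such that $\gcd(A\cup\{m\})=1$. Then $S=\langle\{m\}+(A\cup\{0\})\rangle\in\mathcal{C}(m,e)$. Moreover, every element of $\mathcal{C}(m,e)$ has this form.
   Context: $\mathbb{N}=\{0,1,2,\ldots\}$. A numerical semigroup is a subset $S\subseteq\mathbb{N}$ closed under addition, with $0\in S$ and $\mathbb{N}\setminus S$ finite. For $A\subseteq\mathbb{N}$ nonempty, $\langle A\rangle$ is the submonoid of $(\mathbb{N},+)$ generated by $A$. For $A,B\subseteq\mathbb{N}$, $A+B=\{a+b\mid a\in A,\ b\in B\}$. The multiplicity $m(S)$ is the least positive integer in $S$. Every numerical semigroup has a unique minimal (with respect to inclusion) system of generators, which is finite; it is denoted $\mathrm{msg}(S)$, and its cardinality $e(S)$ is the embedding dimension of $S$. A numerical semigroup $S$ is packed if $\mathrm{msg}(S)\subseteq\{m(S),m(S)+1,\ldots,2m(S)-1\}$; $\mathcal{C}(m,e)$ is the set of all packed numerical semigroups with multiplicity $m$ and embedding dimension $e$. *)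

(* Defs.v *)
From HB Require Import structures.
From mathcomp Require Import all_boot finmap.
From mathcomp Require Import boolp classical_sets functions cardinality fsbigop.
Set Implicit Arguments.
Unset Strict Implicit.
Unset Printing Implicit Defensive.

Local Open Scope classical_set_scope.

Definition submonoid (S : set nat) : Prop :=
  S 0 /\ (forall x y, S x -> S y -> S (x + y)).

Definition generated (A : set nat) : set nat := smallest submonoid A.

Definition numerical_semigroup (S : set nat) : Prop :=
  submonoid S /\ finite_set (~` S).

Definition sumset (A B : set nat) : set nat := [set a + b | a in A & b in B].

Definition is_multiplicity (S : set nat) (m : nat) : Prop :=
  [/\ S m, 0 < m & forall x, S x -> 0 < x -> m <= x].

(* The default 0 is never reached on numerical semigroups: see [multP]. *)
Definition mult (S : set nat) : nat := xget 0 [set m | is_multiplicity S m].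

Definition min_generators (S B : set nat) : Prop :=
  generated B = S /\
  (forall C : set nat, C `<=` B -> generated C = S -> C = B).

(* On a numerical semigroup this is the unique minimal system of generators,
   and it is finite: see [msgP], [msg_unique] and [msg_finite]. *)
Definition msg (S : set nat) : set nat :=
  xget set0 [set B | min_generators S B].

Definition embdim (S : set nat) : nat := #|` fset_set (msg S)|.

Definition packed (S : set nat) : Prop :=
  numerical_semigroup S /\
  msg S `<=` [set x | mult S <= x <= 2 * mult S - 1].

Definition packed_semigroups (m e : nat) : set (set nat) :=
  [set S | [/\ packed S, mult S = m & embdim S = e]].

(* Meaningful for finite [B]: a big operator over a set with infinitely many
   elements different from the neutral element takes the value 0. *)
Definition gcd_set (B : set nat) : nat := \big[gcdn/0]_(b \in B) b.

Lemma generated_submonoid A : submonoid (generated A).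
Proof.
split=> [M [[M0 _] _] //|x y hx hy M [hM AM]].
by apply: hM.2; [apply: hx|apply: hy].
Qed.

Lemma numerical_semigroup_cofinite S : numerical_semigroup S ->
  exists c, forall x, c <= x -> S x.
Proof.
move=> [_ /finite_seqP[s hs]]; exists (\max_(i <- s) i).+1 => x hx.
apply: contrapT => nSx; have : (~` S) x by [].
rewrite hs /= => xs; move: hx; rewrite ltnNge.
by rewrite (leq_bigmax_seq (F := id)).
Qed.

Lemma multP S : numerical_semigroup S -> is_multiplicity S (mult S).
Proof.
move=> hS; apply: (xgetPex 0 (P := [set m | is_multiplicity S m])).
have [c hc] := numerical_semigroup_cofinite hS.
have ex : exists n, `[< S n >] && (0 < n).
  by exists c.+1; rewrite andbT; apply/asboolP/hc.
case: (ex_minnP ex) => n /andP[/asboolP Sn n0] hn; exists n; split=> // x Sx x0.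
by apply: hn; rewrite x0 andbT; apply/asboolP.
Qed.

Definition irreducibles (S : set nat) : set nat :=
  [set x | [/\ S x, 0 < x &
    forall a b, S a -> S b -> 0 < a -> 0 < b -> a + b <> x]].

Lemma generated_irreducibles S : submonoid S -> generated (irreducibles S) = S.
Proof.
move=> hS; apply/seteqP; split.
  by apply: smallest_sub => // x [].
move=> x; elim/ltn_ind: x => -[_ _|x IH Sx].
  exact: (generated_submonoid _).1.
case: (pselect (irreducibles S x.+1)) => [|nirr]; first exact: sub_gen_smallest.
apply: contrapT => ngen; apply: nirr; split=> // a b Sa Sb a0 b0 abx; apply: ngen.
rewrite -abx; apply: (generated_submonoid _).2.
  by apply: IH => //; rewrite -abx -[X in X < _]addn0 ltn_add2l.
by apply: IH => //; rewrite -abx -[X in X < _]add0n ltn_add2r.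
Qed.

Lemma irreducibles_sub S B : generated B = S -> irreducibles S `<=` B.
Proof.
move=> gB x [Sx x0 hx]; apply: contrapT => nBx.
have hS : submonoid S by rewrite -gB; exact: generated_submonoid.
have : S `<=` [set y | S y /\ y <> x].
  rewrite -{1}gB; apply: smallest_sub; last first.
    move=> y By; split; last by move=> yx; apply: nBx; rewrite -yx.
    by rewrite -gB; exact: sub_gen_smallest.
  split=> [|a b [Sa ax] [Sb bx]].
    by split; [exact: hS.1|move=> x0'; rewrite -x0' in x0].
  split; first exact: hS.2.
  case: (posnP a) => [->|a0]; first by rewrite add0n.
  case: (posnP b) => [->|b0]; first by rewrite addn0.
  exact: hx.
by move=> /(_ _ Sx) [].
Qed.

Lemma min_generators_irreducibles S : submonoid S ->
  min_generators S (irreducibles S).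
Proof.
move=> hS; split=> [|C hC gC]; first exact: generated_irreducibles.
by apply/seteqP; split=> //; exact: irreducibles_sub.
Qed.

Lemma msgP S : submonoid S -> min_generators S (msg S).
Proof.
move=> hS; apply: (xgetPex set0 (P := [set B | min_generators S B])).
by exists (irreducibles S); exact: min_generators_irreducibles.
Qed.

Lemma msg_irreducibles S : submonoid S -> msg S = irreducibles S.
Proof.
move=> hS; have [gM hM] := msgP hS; apply/esym/hM.
  exact: irreducibles_sub.
exact: generated_irreducibles.
Qed.

Lemma msg_unique S B : submonoid S -> min_generators S B -> B = msg S.
Proof.
move=> hS [gB hB]; rewrite msg_irreducibles //; apply/esym/hB.
  exact: irreducibles_sub.
exact: generated_irreducibles.
Qed.

Lemma msg_finite S : numerical_semigroup S -> finite_set (msg S).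
Proof.
move=> hS; have [c hc] := numerical_semigroup_cofinite hS.
rewrite (msg_irreducibles hS.1).
apply: (@sub_finite_set _ _ `I_(c.+1 + c.+1)); last exact: finite_II.
move=> x [_ _ hx] /=; rewrite ltnNge; apply/negP => cx.
have cx' : c.+1 <= x by apply: leq_trans cx; rewrite leq_addr.
apply: (hx c.+1 (x - c.+1)) => //; rewrite ?subnKC ?subn_gt0 //.
- by apply: hc.
- by apply: hc; rewrite leq_subRL // (leq_trans _ cx) // leq_add2l.
- by apply: leq_trans cx; rewrite addnS ltnS leq_addr.
Qed.

(* Main.v *)
(* The generators lie in [m, 2m - 1], while a sum of two nonzero elements of S is
   at least 2m: hence every element of a generating set inside that interval is
   irreducible, and such a set is the minimal one.  A submonoid of the naturals is
   cofinite iff its gcd is 1: the differences of its elements are closed under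
   subtraction, so they are the multiples of a common divisor d of S, and d = 1
   gives two consecutive elements. *)
Require Import Defs.
From HB Require Import structures.
From mathcomp Require Import all_boot finmap.
From mathcomp Require Import boolp classical_sets functions cardinality fsbigop.
From mathcomp Require Import zify.
Set Implicit Arguments.
Unset Strict Implicit.
Unset Printing Implicit Defensive.

Local Open Scope classical_set_scope.

Lemma dvdn_gcd_seq d (s : seq nat) :
  (d %| \big[gcdn/0]_(i <- s) i) = all (dvdn d) s.
Proof.
by elim: s => [|a s IH]; rewrite ?big_nil ?dvdn0 // big_cons dvdn_gcd IH.
Qed.

Lemma dvdn_gcd_set d (B : set nat) : finite_set B ->
  d %| gcd_set B <-> forall b, B b -> d %| b.
Proof.
move=> fB; rewrite /gcd_set fsbig_finite //= dvdn_gcd_seq; split.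
  by move=> /allP h b Bb; apply: h; rewrite in_fset_set // inE.
by move=> h; apply/allP => b; rewrite in_fset_set // inE => /h.
Qed.

(** The right-hand side still makes sense for an infinite set such as a semigroup, where [gcd_set]
    would take its default value; the gcd condition is used below in this form. *)
Lemma gcd_set_eq1 (B : set nat) : finite_set B ->
  gcd_set B = 1 <-> forall d, (forall b, B b -> d %| b) -> d = 1.
Proof.
move=> fB; split=> [g1 d /(dvdn_gcd_set d fB)|]; first by rewrite g1 dvdn1 => /eqP.
by apply; apply/(dvdn_gcd_set _ fB).
Qed.

Lemma submonoid_mul (S : set nat) k x : submonoid S -> S x -> S (k * x).
Proof.
by move=> [S0 SD] Sx; elim: k => // k IH; rewrite mulSn; exact: SD.
Qed.

Lemma generated_dvdn d (B : set nat) : (forall b, B b -> d %| b) ->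
  forall x, generated B x -> d %| x.
Proof.
move=> dB; suff : generated B `<=` [set x | d %| x] by [].
by apply: smallest_sub => //; split=> [|x y]; [exact: dvdn0|exact: dvdn_add].
Qed.

Lemma generated_geq m (B : set nat) : (forall b, B b -> m <= b) ->
  forall x, generated B x -> 0 < x -> m <= x.
Proof.
move=> mB; suff : generated B `<=` [set x | 0 < x -> m <= x] by [].
apply: smallest_sub => [|b /mB mb _ //]; split=> [//|x y /= hx hy].
by case: (posnP x) => [->//|/hx mx _]; apply: leq_trans mx (leq_addr _ _).
Qed.

Lemma submonoid_consecutive (S : set nat) : submonoid S ->
  (forall d, (forall s, S s -> d %| s) -> d = 1) -> exists2 s, S s & S s.+1.
Proof.
move=> [S0 SD] gS; pose D x := exists2 s, S s & S (s + x).
have DB x y : D x -> D y -> y <= x -> D (x - y).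
  (* With x = (s + x) - s and y = (t + y) - t, the difference x - y is (s + x + t) - (s + t + y),
     and both terms lie in [S]. *)
  move=> [s Ss Sx] [t St Sy] yx; exists (s + (t + y)); first exact: SD.
  by rewrite (_ : _ + _ = s + x + t); [exact: SD|lia].
have SsubD s : S s -> D s by exists 0.
have ex : exists n, `[< D n >] && (0 < n).
  (* Without a positive difference [S] would be {0}, so 0 would divide all of [S] and [gS] would
     give 0 = 1. *)
  apply: contrapT => nex; suff /gS : forall s, S s -> 0 %| s by [].
  move=> [//|s] /SsubD Ds; case: nex; exists s.+1.
  by rewrite andbT; apply/asboolP.
case: (ex_minnP ex) => d /andP[/asboolP Dd d0] dmin.
have DM x : D x -> d %| x.
  elim/ltn_ind: x => x IH Dx; case: (posnP x) => [->//|x0].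
  have dx : d <= x by apply: dmin; rewrite x0 andbT; apply/asboolP.
  by rewrite -(subnK dx) dvdn_addl //; apply: IH; [lia|exact: DB].
have d1 : d = 1 by apply: gS => s /SsubD /DM.
by case: Dd => s Ss; rewrite d1 addn1 => Ss1; exists s.
Qed.

(** Let s and s + 1 lie in [S], with s positive. If n >= s * s and n = q s + r with r < s, then r <
    s <= q, so n = (q - r) s + r (s + 1) is in [S]. *)
Lemma submonoid_cofinite (S : set nat) : submonoid S ->
  (forall d, (forall s, S s -> d %| s) -> d = 1) -> finite_set (~` S).
Proof.
move=> hS /(submonoid_consecutive hS)[s Ss Ss1].
apply: (@sub_finite_set _ _ `I_(s * s)) (finite_II _) => n /= nSn.
rewrite ltnNge; apply/negP => sn; apply: nSn.
(* Division by s needs s > 0; if s = 0, then s + 1 = 1 already generates everything. *)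
case: (posnP s) => [s0|s0].
  by rewrite -[n]muln1; apply: submonoid_mul => //; rewrite s0 in Ss1.
have rq : n %% s <= n %/ s.
  by apply: leq_trans (ltnW (ltn_pmod _ s0)) _; rewrite leq_divRL.
rewrite (_ : n = (n %/ s - n %% s) * s + (n %% s) * s.+1); last first.
  rewrite mulnS mulnBl addnCA subnK ?leq_mul2r ?rq ?orbT //.
  by rewrite addnC -divn_eq.
by apply: hS.2; exact: submonoid_mul.
Qed.

(** Cofiniteness puts two consecutive integers c and c + 1 in [S]. *)
Lemma numerical_semigroup_dvdn (S : set nat) d : numerical_semigroup S ->
  (forall s, S s -> d %| s) -> d = 1.
Proof.
move=> /numerical_semigroup_cofinite[c hc] dS; apply/eqP; rewrite -dvdn1.
by rewrite -(@dvdn_addr c) ?addn1; apply: dS; apply: hc.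
Qed.

Lemma mult_eq (S : set nat) m : numerical_semigroup S ->
  is_multiplicity S m -> mult S = m.
Proof.
move=> /multP[Sn n0 hn] [Sm m0 hm].
by apply/eqP; rewrite eqn_leq hn //= hm.
Qed.

Lemma msg_generated m (B : set nat) : B `<=` [set x | m <= x < 2 * m] ->
  msg (generated B) = B.
Proof.
move=> hB; have hS := generated_submonoid B; rewrite msg_irreducibles //.
apply/seteqP; split; first exact: irreducibles_sub.
have mB b : B b -> m <= b by move=> /hB /andP[].
move=> b Bb; have /andP[mb bm] := hB b Bb; split; [exact: sub_gen_smallest|lia|].
move=> x y Sx Sy x0 y0 xyb.
by have := generated_geq mB Sx x0; have := generated_geq mB Sy y0; lia.
Qed.

Lemma mult_msg (S : set nat) : numerical_semigroup S -> msg S (mult S).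
Proof.
move=> hS; have [Sm m0 hm] := multP hS; rewrite (msg_irreducibles hS.1).
by split=> // a b Sa Sb a0 b0; have := hm a Sa a0; have := hm b Sb b0; lia.
Qed.

Lemma sumset1E m (B : set nat) : sumset [set m] B = addn m @` B.
Proof.
apply/seteqP; split=> [_ [_ -> [b Bb <-]]|_ [b Bb <-]]; first by exists b.
by exists m => //; exists b.
Qed.

(** Translation by [m] is injective, and 0 is a new element because it is not in [A]. *)
Lemma card_shift m (A : set nat) : finite_set A -> ~ A 0 ->
  #|` fset_set (sumset [set m] (A `|` [set 0]))| = (#|` fset_set A|).+1.
Proof.
move=> fA nA0; have fA0 : finite_set (A `|` [set 0]).
  by rewrite finite_setU; split=> //; exact: finite_set1.
rewrite sumset1E fset_set_image // card_imfset; last exact: addnI.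
rewrite setUC fset_setU1 // cardfsU1.
by rewrite in_fset_set // memNset.
Qed.

Lemma sumset_bounds m (A : set nat) : A `<=` [set a | 1 <= a <= m - 1] ->
  0 < m -> sumset [set m] (A `|` [set 0]) `<=` [set x | m <= x < 2 * m].
Proof.
by move=> hA m0; rewrite sumset1E => _ [a [/hA /= ha|->] <-] /=; lia.
Qed.

(** Since [m] is the translate of 0, a common divisor on either side divides [m], hence divides a
    exactly when it divides m + a. This carries the gcd condition from [A] and [m] to the generators
    and back. *)
Lemma dvdn_shift d m (A : set nat) :
  (forall b, sumset [set m] (A `|` [set 0]) b -> d %| b) <->
  (forall b, (A `|` [set m]) b -> d %| b).
Proof.
rewrite sumset1E; split=> h.
  have dm : d %| m by apply: h; exists 0; [right|rewrite addn0].
  by move=> b [Ab|->//]; rewrite -(dvdn_addr b dm); apply: h; exists b => //; left.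
have dm : d %| m by apply: h; right.
by move=> _ [a [Aa|->] <-]; rewrite dvdn_addr // h //; left.
Qed.

Lemma packed_generated m e (A : set nat) : 0 < m -> 0 < e ->
  A `<=` [set a | 1 <= a <= m - 1] -> (A #= `I_(e - 1))%card ->
  gcd_set (A `|` [set m]) = 1 ->
  packed_semigroups m e (generated (sumset [set m] (A `|` [set 0]))).
Proof.
move=> m0 e0 hA cA gA; set B := sumset _ _; have hB := sumset_bounds hA m0.
have fA : finite_set A by exists (e - 1).
have BS : B `<=` generated B by exact: sub_gen_smallest.
have nS : numerical_semigroup (generated B).
  split; [|apply: submonoid_cofinite]; try exact: generated_submonoid.
  move=> d dS; have fAm : finite_set (A `|` [set m]).
    by rewrite finite_setU; split=> //; exact: finite_set1.
  apply: (gcd_set_eq1 fAm).1 => //; apply/dvdn_shift => b /BS; exact: dS.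
have mS : mult (generated B) = m.
  apply: mult_eq => //; split=> //.
    by apply: BS; rewrite /B sumset1E; exists 0; [right|rewrite addn0].
  by apply: generated_geq => b /hB /andP[].
split=> //; rewrite ?/packed ?/embdim (msg_generated hB) ?mS.
  by split=> // x /hB /=; lia.
rewrite card_shift //; last by move=> /hA.
by rewrite (card_fset_set cA) subn1 prednK.
Qed.

(** The offsets from [m] of the generators other than [m] are positive; the offset 0 is put back
    because the multiplicity is itself a minimal generator. *)
Lemma packed_msg m (S : set nat) : packed S -> mult S = m -> 0 < m ->
  msg S = sumset [set m] ([set a | 0 < a /\ msg S (m + a)] `|` [set 0]).
Proof.
move=> [nS pS] mS m0; rewrite sumset1E; apply/seteqP; split=> [x Mx|x].
  have := pS x Mx; rewrite /= mS => xm; exists (x - m); last by lia.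
  case: (posnP (x - m)) => [->|xm0]; [by right|left; split=> //].
  by rewrite subnKC //; lia.
by move=> [a [[_ Ma]|->] <-] //; rewrite addn0 -mS; exact: mult_msg.
Qed.

Theorem proposition4 (m e : nat) (he : 2 <= e) (hem : e <= m) :
  (forall A : set nat,
     A `<=` [set a | 1 <= a <= m - 1] ->
     (A #= `I_(e - 1))%card ->
     gcd_set (A `|` [set m]) = 1 ->
     packed_semigroups m e (generated (sumset [set m] (A `|` [set 0])))) /\
  (forall S : set nat, packed_semigroups m e S ->
     exists A : set nat,
       [/\ A `<=` [set a | 1 <= a <= m - 1],
           (A #= `I_(e - 1))%card,
           gcd_set (A `|` [set m]) = 1 &
           S = generated (sumset [set m] (A `|` [set 0]))]).
Proof.
have e0 : 0 < e by lia.
have m0 : 0 < m by lia.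
split=> [A|S [pS mS eS]]; first exact: packed_generated.
have nS := pS.1; have [gM _] := msgP nS.1; have MB := packed_msg pS mS m0.
pose A := [set a | 0 < a /\ msg S (m + a)]; rewrite -/A in MB.
have hA : A `<=` [set a | 1 <= a <= m - 1].
  by move=> a [a0 /pS.2 /=]; rewrite mS; lia.
have fA : finite_set A.
  by apply: (@sub_finite_set _ _ `I_m) (finite_II _) => a /hA /=; lia.
exists A; split=> //; last by rewrite -MB gM.
(* The generator [m], of offset 0, is the one that [A] leaves out. *)
- have -> : e - 1 = #|` fset_set A|.
    by rewrite -eS /embdim MB card_shift ?subn1 // => -[].
  by have [n cA] := fA; rewrite (card_fset_set cA).
- have fAm : finite_set (A `|` [set m]).
    by rewrite finite_setU; split=> //; exact: finite_set1.
  (* A common divisor of [A] and [m] divides every minimal generator, hence all of [S], and is 1 by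
     cofiniteness. *)
  apply/(gcd_set_eq1 fAm) => d /dvdn_shift; rewrite -MB => dM.
  by apply: (numerical_semigroup_dvdn nS); rewrite -gM; exact: generated_dvdn.
Qed.
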